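(* Let $A>0$ be such that $\gamma_A$ is irrational, and let $a_j$ ($j\ge0$) be the coefficients of the continued fraction of $\gamma_A$. Assume $a_0=0$, $a_1=2$, $a_3$ is odd, and $a_k$ is even for every $k\ge4$. Fix some integer $j_0\ge3$. (a) If $$\frac{\pi}{\cos(\pi/q_j)\sqrt{R_A^2\cos(\pi/q_{j+1})^2-1}}\,(a_{j+2}+2)\le q_j$$ for every $j\ge j_0$, then $C(A,k)$ holds for every integer $k\ge\tilde q_{j_0}$. (b) If $j_0\ge4$ and $$\max\{F_{A,+}(\delta_{A,\tilde q_{j-1}},\delta_{A,\tilde q_{j-2}}),\,F_{A,-}(\delta_{A,\tilde q_{j-1}})\}<\delta_{A,\tilde q_j}$$ for $j=4,\dots,j_0$, then $C(A,k)$ holds for every integer $k\in[\tilde q_3,\tilde q_{j_0})$. (c) If $3\le\tilde q_2\le\tilde q_3-2$ and $C(A,\tilde q_2-1)$ holds, then $C(A,k)$ holds for every integer $k\in[\tilde q_2,\tilde q_3-2]$.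
   Context: Let $\omega_3=\frac43\pi$. For $A>0$ let $R_A>1$ be given by $A=\omega_3(R_A^2-1)^{3/2}$, and $\gamma_A=\frac1\pi\arctan\big(\sqrt{R_A^2-1}\big)$. Continued fractions: $\gamma_A=[a_0,a_1,a_2,\dots]=a_0+\frac1{a_1+\frac1{a_2+\cdots}}$ with integer coefficients $a_j$ ($a_j\ge 1$ for $j\ge1$). The denominators of the convergents are given by $q_{-1}=0$, $q_0=1$, $q_j=a_jq_{j-1}+q_{j-2}$ for $j\ge1$. Under the parity assumptions of the statement, $q_j$ is odd for every $j\ge2$, and for $j\ge2$ one sets $\tilde q_j=\frac12(q_j+1)\in\mathbb N$. For $x>1$ let $G_A(x)=\arctan(\sqrt{x^2-1})-\arctan(\sqrt{R_A^2-1})$. For $\alpha,\beta\in(0,\pi/2)$, $\alpha\ne\beta$, let $$F_{A,+}(\alpha,\beta)=G_A\!\left(R_A\frac{\sin(\alpha-\beta)}{\sin\alpha-\sin\beta}\right),\qquad F_{A,-}(\alpha)=-G_A(R_A\cos\alpha)$$ (the latter whenever $R_A\cos\alpha>1$). For $k\ge1$ let $\delta_{A,k}=\pi\min_{j\in\mathbb Z}|(2k-1)\gamma_A-j|$. For $k\ge2$ let $\alpha_{A,k}=\min\{\delta_{A,1},\dots,\delta_{A,k}\}$ and $\beta_{A,k}=\min\big(\{\delta_{A,1},\dots,\delta_{A,k}\}\setminus\{\alpha_{A,k}\}\big)$. Condition $C(A,k)$ (for $k\ge2$) is the pair of inequalities $$F_{A,+}(\alpha_{A,k},\beta_{A,k})<\delta_{A,k+1},\qquad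 F_{A,-}(\alpha_{A,k})<\delta_{A,k+1}.$$ (Under the assumptions $a_0=0,a_1=2$, all these quantities are well defined.) *)

(* Defs.v *)
From Stdlib Require Import Reals ZArith ClassicalEpsilon.
Open Scope R_scope.

Definition omega3 : R := 4 / 3 * PI.

Definition irrational (x : R) : Prop :=
  forall p q : Z, (q <> 0)%Z -> x <> IZR p / IZR q.

Definition is_minimum (E : R -> Prop) (m : R) : Prop :=
  E m /\ forall y : R, E y -> m <= y.

(* The value is arbitrary when [E] has no least element. *)
Definition minimum (E : R -> Prop) : R := epsilon (inhabits 0) (is_minimum E).

Lemma minimum_eq (E : R -> Prop) (m : R) : is_minimum E m -> minimum E = m.
Proof.
intros Hm.
assert (H : is_minimum E (minimum E)).
{ unfold minimum; apply epsilon_spec; now exists m. }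
apply Rle_antisym; [apply H, Hm | apply Hm, H].
Qed.

(* [cfrac a n] is the finite continued fraction [a 0; a 1, ..., a n]. *)
Fixpoint cfrac (a : nat -> Z) (n : nat) : R :=
  match n with
  | O => IZR (a O)
  | S m => IZR (a O) + 1 / cfrac (fun j => a (S j)) m
  end.

Definition is_cont_frac (a : nat -> Z) (x : R) : Prop :=
  (forall j : nat, (1 <= j)%nat -> (1 <= a j)%Z) /\ Un_cv (cfrac a) x.

(* The inner [match] returns the convention q_(-1) = 0. *)
Fixpoint cf_den (a : nat -> Z) (n : nat) : Z :=
  match n with
  | O => 1
  | S m => a n * cf_den a m + match m with O => 0 | S l => cf_den a l end
  end%Z.

(* Only meant for odd denominators, where the integer division is exact. *)
Definition qtilde (a : nat -> Z) (j : nat) : Z := ((cf_den a j + 1) / 2)%Z.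

(* Below, [r] stands for the number R_A > 1 attached to A > 0; the
   quantities indexed by A depend on A only through R_A. *)

Definition gam (r : R) : R := 1 / PI * atan (sqrt (r ^ 2 - 1)).

Definition G (r x : R) : R := atan (sqrt (x ^ 2 - 1)) - atan (sqrt (r ^ 2 - 1)).

Definition Fplus (r alpha beta : R) : R :=
  G r (r * (sin (alpha - beta) / (sin alpha - sin beta))).

Definition Fminus (r alpha : R) : R := - G r (r * cos alpha).

Definition delta (r : R) (k : Z) : R :=
  PI * minimum (fun y => exists j : Z, y = Rabs (IZR (2 * k - 1) * gam r - IZR j)).

Definition delta_set (r : R) (k : Z) (y : R) : Prop :=
  exists i : Z, (1 <= i <= k)%Z /\ y = delta r i.

Definition alphaA (r : R) (k : Z) : R := minimum (delta_set r k).

Definition betaA (r : R) (k : Z) : R :=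
  minimum (fun y => delta_set r k y /\ y <> alphaA r k).

Definition condC (r : R) (k : Z) : Prop :=
  Fplus r (alphaA r k) (betaA r k) < delta r (k + 1) /\
  Fminus r (alphaA r k) < delta r (k + 1).

(* Main.v *)
Require Import Defs.
From Stdlib Require Import Reals ZArith ClassicalEpsilon.
From Stdlib Require Import Lra Lia List.
Open Scope R_scope.

(* Write [d_j] for the distance from [q_j * gam r] to the integers. Since [q_j]
   is odd for [j >= 2], the best approximation property of convergents gives
   [alphaA r k = PI * d_j] for every [k] in [qtilde j, qtilde (j+1)), while
   [betaA r k <= PI * d_(j-1)] (if [j >= 3]) and
   [delta r (k+1) >= PI * d_(j+1)]. In terms of the tangents [t], [s] of the
   half angles, the argument of [G] in [Fplus] is [r * (1 + t s) / (1 - t s)],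
   so [Fplus] and [Fminus] are increasing, and [condC r k] on this whole range
   follows from the single inequality of (b) at the index [j+1]. Part (c) is the
   same monotonicity: up to [qtilde 3 - 1] no [delta] is below that at [qtilde 2].
   For (a), the mean value theorem bounds [Fplus] and [Fminus] by a constant
   times [d_j * d_(j-1)]; as [d_j < 1 / q_(j+1)] and
   [d_(j+1) > 1 / ((a_(j+2) + 2) * q_(j+1))], the growth hypothesis at [j]
   implies the inequality of (b) at [j+1]. The square root there is genuine
   because [gam r > 1/3] forces [r > 2]. *)

(** * Minima of finite sets of reals; irrational multiples *)

Lemma minimum_spec (E : R -> Prop) (m : R) :
  is_minimum E m -> is_minimum E (minimum E).
Proof. intros Hm; now rewrite (minimum_eq E m Hm). Qed.

(** The list only has to cover [E], so one can drop its head and pass to the elements of [E] other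
    than [x], with no decision procedure for [E]. *)
Lemma finite_has_minimum (l : list R) (E : R -> Prop) :
  (forall y, E y -> In y l) -> (exists y, E y) -> exists m, is_minimum E m.
Proof.
revert E; induction l as [|x l IH]; intros E Hl [y0 Hy0].
{ now destruct (Hl y0 Hy0). }
destruct (classic (exists y, E y /\ y <> x)) as [Hex | Hno].
- destruct (IH (fun y => E y /\ y <> x)) as [m [[Hm1 Hm2] Hm3]]; auto.
  { intros y [Hy Hyx]; destruct (Hl y Hy); [congruence | assumption]. }
  destruct (classic (E x /\ x < m)) as [[Hx Hxm] | Hx].
  + exists x; split; [exact Hx | intros y Hy].
    destruct (Req_dec y x) as [-> | Hyx]; [lra |].
    specialize (Hm3 y (conj Hy Hyx)); lra.
  + exists m; split; [exact Hm1 | intros y Hy].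
    destruct (Req_dec y x) as [-> | Hyx]; [| now apply Hm3].
    destruct (Rle_or_lt m x); [assumption | tauto].
- assert (Hall : forall y, E y -> y = x).
  { intros y Hy; apply NNPP; intros Hyx; apply Hno; eauto. }
  exists y0; split; [exact Hy0 | intros y Hy].
  rewrite (Hall y Hy), (Hall y0 Hy0); lra.
Qed.

Lemma irrational_affine (x : R) (m p : Z) :
  irrational x -> m <> 0%Z -> IZR m * x <> IZR p.
Proof.
intros Hx Hm H; apply (Hx p m Hm); rewrite <- H; field.
now apply not_0_IZR.
Qed.

(** * Continued fractions *)

Fixpoint cf_num (a : nat -> Z) (n : nat) : Z :=
  match n with
  | O => a O
  | S m => a n * cf_num a m + match m with O => 1 | S l => cf_num a l end
  end%Z.

Definition cf_err (a : nat -> Z) (x : R) (n : nat) : R :=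
  IZR (cf_den a n) * x - IZR (cf_num a n).

(** Convergents lie alternately below and above an irrational [x], so this sign yields the distance
    while keeping it linear in [x]. *)
Definition cf_dist (a : nat -> Z) (x : R) (n : nat) : R :=
  (-1) ^ n * cf_err a x n.

Lemma cf_den_SS (a : nat -> Z) (n : nat) :
  cf_den a (S (S n)) = (a (S (S n)) * cf_den a (S n) + cf_den a n)%Z.
Proof. reflexivity. Qed.

Lemma cf_num_SS (a : nat -> Z) (n : nat) :
  cf_num a (S (S n)) = (a (S (S n)) * cf_num a (S n) + cf_num a n)%Z.
Proof. reflexivity. Qed.

Lemma cf_err_SS (a : nat -> Z) (x : R) (n : nat) :
  cf_err a x (S (S n)) = IZR (a (S (S n))) * cf_err a x (S n) + cf_err a x n.
Proof.
unfold cf_err; rewrite cf_den_SS, cf_num_SS, !plus_IZR, !mult_IZR; ring.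
Qed.

Lemma cf_det (a : nat -> Z) (n : nat) :
  (cf_num a (S n) * cf_den a n - cf_den a (S n) * cf_num a n
   = (-1) ^ Z.of_nat n)%Z.
Proof.
induction n as [|n IH].
- cbn; ring.
- rewrite cf_den_SS, cf_num_SS, Nat2Z.inj_succ, Z.pow_succ_r, <- IH by lia.
  ring.
Qed.

Lemma cf_den_pos (a : nat -> Z) (n : nat) :
  (forall j, (1 <= j)%nat -> (1 <= a j)%Z) -> (1 <= cf_den a n)%Z.
Proof.
intros Ha.
enough (H : (1 <= cf_den a n /\ 1 <= cf_den a (S n))%Z) by apply H.
induction n as [|n [IH1 IH2]].
- specialize (Ha 1%nat (le_n _)); cbn; lia.
- split; [exact IH2 | rewrite cf_den_SS].
  specialize (Ha (S (S n)) ltac:(lia)); nia.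
Qed.

Lemma cf_den_lt (a : nat -> Z) (n : nat) :
  (forall j, (1 <= j)%nat -> (1 <= a j)%Z) -> (1 <= n)%nat ->
  (cf_den a n < cf_den a (S n))%Z.
Proof.
intros Ha Hn; destruct n as [|n]; [lia |].
rewrite cf_den_SS; pose proof (cf_den_pos a n Ha).
pose proof (cf_den_pos a (S n) Ha); specialize (Ha (S (S n)) ltac:(lia)); nia.
Qed.

Lemma cfrac_ext (a b : nat -> Z) (n : nat) :
  (forall j, a j = b j) -> cfrac a n = cfrac b n.
Proof.
revert a b; induction n as [|n IH]; intros a b Hab; cbn; rewrite (Hab O).
- reflexivity.
- now rewrite (IH _ (fun j => b (S j))) by (intros; apply Hab).
Qed.

Lemma cfrac_ge1 (a : nat -> Z) (n : nat) :
  (forall j, (1 <= a j)%Z) -> 1 <= cfrac a n.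
Proof.
revert a; induction n as [|n IH]; intros a Ha; cbn;
  pose proof (IZR_le _ _ (Ha O)).
- assumption.
- specialize (IH (fun j => a (S j)) ltac:(intros; apply Ha)); cbn in IH.
  assert (0 < 1 / cfrac (fun j => a (S j)) n)
    by (apply Rdiv_lt_0_compat; lra).
  lra.
Qed.

(** One step of the Gauss map. The tail converges because inversion is continuous away from 0; its
    values are at least 1, hence so is [y], and irrationality excludes equality. *)
Lemma is_cont_frac_tail (a : nat -> Z) (x : R) :
  is_cont_frac a x -> irrational x ->
  let y := 1 / (x - IZR (a O)) in
  is_cont_frac (fun j => a (S j)) y /\ irrational y /\ 1 < y.
Proof.
intros [Ha Hcv] Hx y.
assert (Hne : x - IZR (a O) <> 0).
{ intros H; apply (Hx (a O) 1%Z); [lia | lra]. }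
assert (Hge : forall n, 1 <= cfrac (fun j => a (S j)) n).
{ intros n; apply cfrac_ge1; intros j; apply Ha; lia. }
assert (Hy : Un_cv (cfrac (fun j => a (S j))) y).
{ assert (Hinv : Un_cv (fun n => / (cfrac a (S n) - IZR (a O)))
                   (/ (x - IZR (a O)))).
  { apply (continuity_seq Rinv (fun n => cfrac a (S n) - IZR (a O))).
    - apply (continuity_pt_inv id); [| exact Hne].
      apply derivable_continuous_pt, derivable_pt_id.
    - intros eps Heps; destruct (Hcv eps Heps) as [N HN].
      exists N; intros n Hn; specialize (HN (S n) ltac:(lia)).
      unfold Rdist in *.
      replace (cfrac a (S n) - IZR (a O) - (x - IZR (a O)))
        with (cfrac a (S n) - x) by ring.
      exact HN. }
  intros eps Heps; destruct (Hinv eps Heps) as [N HN].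
  exists N; intros n Hn; specialize (HN n Hn); unfold y.
  replace (1 / (x - IZR (a O))) with (/ (x - IZR (a O))) by (field; exact Hne).
  replace (cfrac (fun j => a (S j)) n) with (/ (cfrac a (S n) - IZR (a O))).
  { exact HN. }
  cbn; specialize (Hge n); cbn in Hge; field; lra. }
assert (Hirr : irrational y).
{ intros p q Hq H.
  assert (Hq' := not_0_IZR q Hq).
  assert (Hp : IZR p <> 0).
  { intros Hp; rewrite Hp in H; unfold y in H.
    assert (H' : 1 / (x - IZR (a O)) * (x - IZR (a O)) = 1) by (field; exact Hne).
    rewrite H in H'; unfold Rdiv in H'; lra. }
  apply (Hx (a O * p + q)%Z p); [now intros -> |].
  rewrite plus_IZR, mult_IZR.
  assert (H1 : x - IZR (a O) = 1 / y) by (unfold y; field; exact Hne).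
  rewrite H in H1.
  replace x with (IZR (a O) + (x - IZR (a O))) by ring.
  rewrite H1; field; split; assumption. }
split; [split |split].
- intros j Hj; apply Ha; lia.
- exact Hy.
- exact Hirr.
- assert (1 <= y).
  { apply Rnot_lt_le; intros Hlt.
    destruct (Hy (1 - y)) as [N HN]; [lra |].
    specialize (HN N (le_n _)); specialize (Hge N); unfold Rdist in HN.
    rewrite Rabs_right in HN by lra; lra. }
  destruct (Req_dec y 1) as [H1 | H1]; [| lra].
  exfalso; apply (Hirr 1%Z 1%Z); [lia | lra].
Qed.

(* [y] is the complete quotient with expansion [a (n+1), a (n+2), etc]. *)
Lemma complete_quotient (a : nat -> Z) (x : R) (n : nat) :
  is_cont_frac a x -> irrational x ->
  exists y, is_cont_frac (fun j => a (S n + j)%nat) y /\ irrational y /\ 1 < y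
    /\ cf_err a x n * y = match n with O => 1 | S m => - cf_err a x m end.
Proof.
intros Hcf Hx; induction n as [|n [y [Hy [Hirr [Hy1 He]]]]].
- pose proof (is_cont_frac_tail a x Hcf Hx) as [H1 [H2 H3]].
  eexists; repeat split; try eassumption; try apply H1.
  unfold cf_err; cbn; field.
  intros H; apply (Hx (a O) 1%Z); [lia | lra].
- pose proof (is_cont_frac_tail _ y Hy Hirr) as [H1 [H2 H3]].
  cbv beta in H1, H2, H3; rewrite Nat.add_0_r in H1, H2, H3.
  assert (Hne : y - IZR (a (S n)) <> 0).
  { intros H; apply (Hirr (a (S n)) 1%Z); [lia | lra]. }
  eexists; repeat split; [ | | exact H2 | exact H3 | ].
  + intros j Hj; apply (proj1 Hcf); lia.
  + intros eps Heps; destruct (proj2 H1 eps Heps) as [N HN].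
    exists N; intros m Hm; specialize (HN m Hm).
    erewrite cfrac_ext; [exact HN |].
    intros j; cbv beta; f_equal; lia.
  + enough (cf_err a x (S n) = - cf_err a x n * (y - IZR (a (S n))))
      as -> by (field; exact Hne).
    destruct n as [|n].
    * unfold cf_err in *; cbn in *.
      rewrite !plus_IZR, !mult_IZR; nra.
    * rewrite cf_err_SS; nra.
Qed.

(** With the complete quotient [y > 1], the relation [e_(n+1) * y = - e_n] makes the errors
    alternate in sign and shrink strictly. *)
Lemma cf_dist_decr (a : nat -> Z) (x : R) (n : nat) :
  is_cont_frac a x -> irrational x ->
  0 < cf_dist a x (S n) < cf_dist a x n.
Proof.
intros Hcf Hx.
assert (Hpos : 0 < cf_dist a x n).
{ induction n as [|n IH];
    [destruct (complete_quotient a x 0 Hcf Hx) as [y [_ [_ [Hy He]]]]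
    |destruct (complete_quotient a x (S n) Hcf Hx) as [y [_ [_ [Hy He]]]]];
    unfold cf_dist in *; cbn [pow] in *; nra. }
destruct (complete_quotient a x (S n) Hcf Hx) as [y [_ [_ [Hy He]]]].
unfold cf_dist in *; cbn [pow] in *.
split; nra.
Qed.

(** The terms in [x] cancel and the determinant of consecutive convergents remains. Both the upper
    and the lower bounds for [cf_dist] come from this identity. *)
Lemma cf_dist_den (a : nat -> Z) (x : R) (n : nat) :
  IZR (cf_den a (S n)) * cf_dist a x n + IZR (cf_den a n) * cf_dist a x (S n) = 1.
Proof.
assert (H := f_equal IZR (cf_det a n)).
rewrite minus_IZR, !mult_IZR, <- pow_IZR in H.
assert (H1 : (-1) ^ n * (-1) ^ n = 1).
{ rewrite <- Rpow_mult_distr; replace (-1 * -1) with 1 by ring; apply pow1. }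
transitivity ((-1) ^ n * (-1) ^ n); [rewrite <- H at 2 | exact H1].
unfold cf_dist, cf_err; cbn [pow]; ring.
Qed.

(** By [cf_det], two consecutive pairs (denominator, numerator) form a basis of the integer lattice.
    In it [(m, p)] has coordinates [u], [v], given by Cramer's rule, and the range of [m] forces [u]
    to be nonzero. *)
Lemma cf_best_approx (a : nat -> Z) (x : R) (n : nat) (m p : Z) :
  is_cont_frac a x -> irrational x ->
  (0 < m < cf_den a (S n))%Z -> cf_dist a x n <= Rabs (IZR m * x - IZR p).
Proof.
intros Hcf Hx Hm.
destruct (cf_dist_decr a x n Hcf Hx) as [Hd1 Hd0].
pose proof (cf_den_pos a n (proj1 Hcf)) as Hq.
set (e := ((-1) ^ Z.of_nat n)%Z).
assert (Hee : (e * e = 1)%Z).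
{ unfold e; rewrite <- Z.pow_mul_l; now rewrite Z.pow_1_l by lia. }
assert (Hdet := cf_det a n); fold e in Hdet.
set (u := (e * (m * cf_num a (S n) - p * cf_den a (S n)))%Z).
set (v := (e * (p * cf_den a n - m * cf_num a n))%Z).
assert (Hmuv : (m = u * cf_den a n + v * cf_den a (S n))%Z).
{ transitivity (m * (e * e))%Z; [rewrite Hee; ring |].
  rewrite <- Hdet at 2; unfold u, v; ring. }
assert (Hpuv : (p = u * cf_num a n + v * cf_num a (S n))%Z).
{ transitivity (p * (e * e))%Z; [rewrite Hee; ring |].
  rewrite <- Hdet at 2; unfold u, v; ring. }
assert (Hval : Rabs (IZR m * x - IZR p)
               = Rabs (IZR u * cf_dist a x n - IZR v * cf_dist a x (S n))).
{ transitivity (Rabs ((-1) ^ n * (IZR m * x - IZR p))).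
  - now rewrite Rabs_mult, pow_1_abs, Rmult_1_l.
  - f_equal; rewrite Hmuv at 1; rewrite Hpuv at 1.
    rewrite !plus_IZR, !mult_IZR; unfold cf_dist, cf_err; cbn [pow]; ring. }
rewrite Hval; clearbody u v; clear Hval Hpuv.
(* The two errors have opposite signs, and so do [u] and [v] unless [v = 0]:
   nothing cancels. *)
assert (Hcases : (1 <= u /\ v <= 0 \/ u <= -1 /\ 0 <= v)%Z).
{ destruct (Z_le_gt_dec v 0) as [Hv | Hv]; [left | right].
  - assert (0 < u * cf_den a n)%Z by nia; nia.
  - assert (u * cf_den a n < 0)%Z by nia; nia. }
destruct Hcases as [[Hu Hv] | [Hu Hv]];
  apply IZR_le in Hu; apply IZR_le in Hv.
- rewrite Rabs_right by nra; nra.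
- rewrite Rabs_left1 by nra; nra.
Qed.

(** * The odd multiples of [gam r] modulo the integers *)

Lemma nearest_integer (t : R) :
  exists j : Z, Rabs (t - IZR j) <= 1 / 2 /\
    is_minimum (fun y => exists i : Z, y = Rabs (t - IZR i)) (Rabs (t - IZR j)).
Proof.
(* Rounding to the nearest integer; every other integer is at distance at least 1/2. *)
set (j := Int_part (t + 1 / 2)).
destruct (base_Int_part (t + 1 / 2)) as [H1 H2]; fold j in H1, H2.
assert (Hj : Rabs (t - IZR j) <= 1 / 2) by (apply Rabs_le; lra).
exists j; split; [exact Hj | split; [now exists j |]].
intros y [i ->]; destruct (Z.eq_dec i j) as [-> | Hij]; [lra |].
apply Rle_trans with (1 / 2); [exact Hj |].
assert (H : (i <= j - 1 \/ j + 1 <= i)%Z) by lia.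
destruct H as [H | H]; apply IZR_le in H;
  rewrite ?minus_IZR, ?plus_IZR in H.
- rewrite Rabs_right; lra.
- rewrite Rabs_left1; lra.
Qed.

Lemma delta_spec (r : R) (k : Z) :
  exists j : Z, delta r k = PI * Rabs (IZR (2 * k - 1) * gam r - IZR j) /\
    delta r k <= PI / 2 /\
    forall i : Z, delta r k <= PI * Rabs (IZR (2 * k - 1) * gam r - IZR i).
Proof.
destruct (nearest_integer (IZR (2 * k - 1) * gam r)) as [j [Hj Hmin]].
pose proof PI_RGT_0 as HPI; pose proof (minimum_eq _ _ Hmin) as Heq.
exists j; unfold delta; rewrite Heq; split; [reflexivity | split; [nra |]].
intros i; apply Rmult_le_compat_l; [lra | apply Hmin; now exists i].
Qed.

(** At either endpoint a nonzero integer multiple of [gam r] would be an integer: the factor is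
    [2k - 1] for 0 and twice that for [PI / 2]. *)
Lemma delta_bounds (r : R) (k : Z) :
  irrational (gam r) -> 0 < delta r k < PI / 2.
Proof.
intros Hirr; pose proof PI_RGT_0 as HPI.
destruct (delta_spec r k) as [j [Hj [Hle _]]].
assert (H1 : IZR (2 * k - 1) * gam r - IZR j <> 0).
{ intros H; apply (irrational_affine (gam r) (2 * k - 1) j Hirr); [lia | lra]. }
apply Rabs_pos_lt in H1; split; [rewrite Hj; nra |].
destruct Hle as [Hlt | Heq]; [exact Hlt | exfalso].
assert (Habs : Rabs (IZR (2 * k - 1) * gam r - IZR j) = 1 / 2).
{ rewrite Heq in Hj; apply Rmult_eq_reg_l with PI; lra. }
assert (Hor : IZR (2 * (2 * k - 1)) * gam r = IZR (2 * j + 1)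
           \/ IZR (2 * (2 * k - 1)) * gam r = IZR (2 * j - 1)).
{ rewrite mult_IZR, plus_IZR, (minus_IZR (2 * j)), (mult_IZR 2 j).
  destruct (Rcase_abs (IZR (2 * k - 1) * gam r - IZR j)) as [Hn | Hn];
    [rewrite Rabs_left in Habs by exact Hn
    |rewrite Rabs_right in Habs by exact Hn]; [right | left]; lra. }
destruct Hor as [H | H]; revert H; apply irrational_affine; auto; lia.
Qed.

(** Equal distances make the sum or the difference of two odd multiples of [gam r] an integer; the
    sum has a nonzero factor because [k] and [l] are positive. *)
Lemma delta_inj (r : R) (k l : Z) :
  irrational (gam r) -> (1 <= k)%Z -> (1 <= l)%Z ->
  delta r k = delta r l -> k = l.
Proof.
intros Hirr Hk Hl Heq; pose proof PI_RGT_0 as HPI.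
destruct (delta_spec r k) as [i [Hi _]]; destruct (delta_spec r l) as [j [Hj _]].
rewrite Hi, Hj in Heq; apply Rmult_eq_reg_l in Heq; [| lra].
destruct (Z.eq_dec k l) as [| Hne]; [assumption | exfalso].
assert (Hor : IZR (2 * k - 1 - (2 * l - 1)) * gam r = IZR (i - j)
           \/ IZR (2 * k - 1 + (2 * l - 1)) * gam r = IZR (i + j)).
{ rewrite plus_IZR, (plus_IZR i), (minus_IZR (2 * k - 1)), (minus_IZR i).
  revert Heq; unfold Rabs.
  destruct (Rcase_abs (IZR (2 * k - 1) * gam r - IZR i));
    destruct (Rcase_abs (IZR (2 * l - 1) * gam r - IZR j)); intros Heq; lra. }
destruct Hor as [H | H]; revert H; apply irrational_affine; auto; lia.
Qed.

Lemma delta_set_finite (r : R) (k : Z) :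
  exists l, forall y, delta_set r k y -> In y l.
Proof.
exists (map (fun n => delta r (Z.of_nat n)) (seq 1 (Z.to_nat k))).
intros y [i [Hi ->]]; apply in_map_iff; exists (Z.to_nat i); split.
- f_equal; lia.
- apply in_seq; lia.
Qed.

Lemma alphaA_spec (r : R) (k : Z) :
  (1 <= k)%Z -> is_minimum (delta_set r k) (alphaA r k).
Proof.
intros Hk; destruct (delta_set_finite r k) as [l Hl].
destruct (finite_has_minimum l (delta_set r k) Hl) as [m Hm].
- exists (delta r 1), 1%Z; split; [lia | reflexivity].
- exact (minimum_spec _ _ Hm).
Qed.

(** The set is nonempty because the first two values of [delta] differ, so one of them is not the
    minimum. *)
Lemma betaA_spec (r : R) (k : Z) :
  irrational (gam r) -> (2 <= k)%Z ->
  is_minimum (fun y => delta_set r k y /\ y <> alphaA r k) (betaA r k).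
Proof.
intros Hirr Hk; destruct (delta_set_finite r k) as [l Hl].
destruct (finite_has_minimum l (fun y => delta_set r k y /\ y <> alphaA r k))
  as [m Hm].
- intros y [Hy _]; exact (Hl y Hy).
- destruct (Req_dec (delta r 1) (alphaA r k)) as [H1 | H1].
  + exists (delta r 2); split; [exists 2%Z; split; [lia | reflexivity] |].
    intros H2; rewrite <- H1 in H2; apply delta_inj in H2; auto; lia.
  + exists (delta r 1); split; [exists 1%Z; split; [lia | reflexivity] | exact H1].
- exact (minimum_spec _ _ Hm).
Qed.

Lemma alphaA_betaA_bounds (r : R) (k : Z) :
  irrational (gam r) -> (2 <= k)%Z -> 0 < alphaA r k < betaA r k /\ betaA r k < PI / 2.
Proof.
intros Hirr Hk.
destruct (alphaA_spec r k ltac:(lia)) as [[i [Hi Ha]] Hamin].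
destruct (betaA_spec r k Hirr Hk) as [[[j [Hj Hb]] Hab] _].
pose proof (Hamin _ (ex_intro _ j (conj Hj Hb))).
pose proof (delta_bounds r i Hirr); pose proof (delta_bounds r j Hirr).
lra.
Qed.

Lemma alphaA_decr (r : R) (k l : Z) :
  (1 <= k <= l)%Z -> alphaA r l <= alphaA r k.
Proof.
intros Hkl; destruct (alphaA_spec r k ltac:(lia)) as [[i [Hi Ha]] _].
apply (alphaA_spec r l ltac:(lia)); exists i; split; [lia | exact Ha].
Qed.

(** The old second minimum exceeds the old minimum, hence also the new one, so it still competes for
    the new second minimum. *)
Lemma betaA_decr (r : R) (k l : Z) :
  irrational (gam r) -> (2 <= k <= l)%Z -> betaA r l <= betaA r k.
Proof.
intros Hirr Hkl; destruct (betaA_spec r k Hirr ltac:(lia)) as [[[i [Hi Hb]] _] _].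
apply (betaA_spec r l Hirr ltac:(lia)).
pose proof (alphaA_decr r k l ltac:(lia)).
pose proof (alphaA_betaA_bounds r k Hirr ltac:(lia)).
split; [exists i; split; [lia | exact Hb] | lra].
Qed.

Lemma qtilde_odd (a : nat -> Z) (j : nat) :
  Z.Odd (cf_den a j) -> cf_den a j = (2 * qtilde a j - 1)%Z.
Proof.
intros [m Hm]; unfold qtilde; rewrite Hm.
replace (2 * m + 1 + 1)%Z with ((m + 1) * 2)%Z by ring.
rewrite Z.div_mul by lia; lia.
Qed.

Lemma delta_ge_cf_dist (r : R) (a : nat -> Z) (n : nat) (k : Z) :
  is_cont_frac a (gam r) -> irrational (gam r) ->
  (1 <= k)%Z -> (2 * k - 1 < cf_den a (S n))%Z ->
  PI * cf_dist a (gam r) n <= delta r k.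
Proof.
intros Hcf Hirr Hk Hlt; destruct (delta_spec r k) as [j [-> _]].
apply Rmult_le_compat_l; [pose proof PI_RGT_0; lra |].
apply cf_best_approx; auto; lia.
Qed.

(** The numerator of the convergent realizes the lower bound given by best approximation. *)
Lemma delta_qtilde (r : R) (a : nat -> Z) (n : nat) :
  is_cont_frac a (gam r) -> irrational (gam r) ->
  (1 <= n)%nat -> Z.Odd (cf_den a n) ->
  delta r (qtilde a n) = PI * cf_dist a (gam r) n.
Proof.
intros Hcf Hirr Hn Hodd; pose proof (qtilde_odd a n Hodd) as Hq.
pose proof (cf_den_pos a n (proj1 Hcf)).
pose proof (cf_den_lt a n (proj1 Hcf) Hn).
apply Rle_antisym.
- destruct (delta_spec r (qtilde a n)) as [_ [_ [_ Hle]]].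
  specialize (Hle (cf_num a n)); rewrite <- Hq in Hle.
  destruct (cf_dist_decr a (gam r) n Hcf Hirr).
  enough (Rabs (IZR (cf_den a n) * gam r - IZR (cf_num a n)) = cf_dist a (gam r) n)
    as <- by exact Hle.
  change (Rabs (cf_err a (gam r) n) = cf_dist a (gam r) n).
  rewrite <- (Rabs_right (cf_dist a (gam r) n)) by lra.
  unfold cf_dist; now rewrite Rabs_mult, pow_1_abs, Rmult_1_l.
- apply delta_ge_cf_dist; auto; lia.
Qed.

Lemma alphaA_qtilde (r : R) (a : nat -> Z) (n : nat) (k : Z) :
  is_cont_frac a (gam r) -> irrational (gam r) ->
  (1 <= n)%nat -> Z.Odd (cf_den a n) -> Z.Odd (cf_den a (S n)) ->
  (qtilde a n <= k < qtilde a (S n))%Z ->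
  alphaA r k = delta r (qtilde a n).
Proof.
intros Hcf Hirr Hn Hodd Hodd' Hk.
pose proof (qtilde_odd a n Hodd); pose proof (qtilde_odd a (S n) Hodd').
pose proof (cf_den_pos a n (proj1 Hcf)).
apply minimum_eq; split.
- exists (qtilde a n); split; [lia | reflexivity].
- intros y [i [Hi ->]]; rewrite (delta_qtilde r a n) by assumption.
  apply delta_ge_cf_dist; auto; lia.
Qed.

(** * Monotonicity and size of [Fplus] and [Fminus] *)

Lemma G_incr (r x y : R) : 0 <= x <= y -> G r x <= G r y.
Proof.
intros Hxy; unfold G.
assert (sqrt (x ^ 2 - 1) <= sqrt (y ^ 2 - 1)) by (apply sqrt_le_1_alt; nra).
destruct (Req_dec (sqrt (x ^ 2 - 1)) (sqrt (y ^ 2 - 1))) as [-> | Hne]; [lra |].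
pose proof (atan_increasing (sqrt (x ^ 2 - 1)) (sqrt (y ^ 2 - 1))); lra.
Qed.

(** Half-angle formulas: the common factor [sin ((v - u) / 2)] cancels. *)
Lemma sin_ratio (u v : R) :
  0 < u < v -> v < PI / 2 ->
  sin (u - v) / (sin u - sin v) = cos ((v - u) / 2) / cos ((u + v) / 2).
Proof.
intros Huv Hv.
assert (Hc : 0 < cos ((u + v) / 2)) by (apply cos_gt_0; lra).
assert (Hs : 0 < sin ((v - u) / 2)) by (apply sin_gt_0; lra).
replace (u - v) with (- (2 * ((v - u) / 2))) by field.
replace (sin u - sin v) with (- (2 * sin ((v - u) / 2) * cos ((u + v) / 2))).
{ rewrite sin_neg, sin_2a; field; lra. }
pose proof (form4 v u); replace ((u + v) / 2) with ((v + u) / 2) by field; lra.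
Qed.

(** The quotient becomes a function of [w = tan u * tan v] alone, namely [1 + 2 w / (1 - w)], which
    increases for [w < 1]. *)
Lemma cos_ratio_tan (u v : R) :
  cos u <> 0 -> cos v <> 0 -> cos (u + v) <> 0 ->
  cos (v - u) / cos (u + v) = 1 + 2 * (tan u * tan v / (1 - tan u * tan v)).
Proof.
intros Hu Hv Huv.
assert (H : 1 - tan u * tan v = cos (u + v) / (cos u * cos v)).
{ rewrite cos_plus; unfold tan; field; auto. }
rewrite H, cos_minus; unfold tan.
apply Rmult_eq_reg_r with (cos (u + v)); [| exact Huv].
field_simplify; auto; rewrite cos_plus; field; auto.
Qed.

Lemma tan_half_le (u v : R) : 0 < u <= v -> v < PI / 2 -> 0 < tan (u / 2) <= tan (v / 2).
Proof.
intros Huv Hv; split; [apply tan_gt_0; lra |].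
destruct (Req_dec u v) as [-> | Hne]; [lra |].
left; apply tan_increasing; lra.
Qed.

Lemma Fplus_incr (r u v u' v' : R) :
  0 < r -> 0 < u < v -> u' < v' -> v' < PI / 2 -> u <= u' -> v <= v' ->
  Fplus r u v <= Fplus r u' v'.
Proof.
intros Hr Huv Huv' Hv' Hu Hv; unfold Fplus.
assert (Hc : forall x y, 0 < x -> x < PI / 2 -> 0 < y -> y < PI / 2 ->
           0 < cos ((x + y) / 2)) by (intros; apply cos_gt_0; lra).
assert (Hh : forall x, 0 < x -> x < PI / 2 -> 0 < cos (x / 2))
  by (intros; apply cos_gt_0; lra).
pose proof (Hc u v ltac:(lra) ltac:(lra) ltac:(lra) ltac:(lra)) as Hc1.
pose proof (Hc u' v' ltac:(lra) ltac:(lra) ltac:(lra) ltac:(lra)) as Hc2.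
pose proof (Hh u ltac:(lra) ltac:(lra)); pose proof (Hh v ltac:(lra) ltac:(lra)).
pose proof (Hh u' ltac:(lra) ltac:(lra)); pose proof (Hh v' ltac:(lra) ltac:(lra)).
(* The half angles add up to less than [PI / 2], so the cosine of their sum is positive. *)
assert (Ht : tan (u' / 2) * tan (v' / 2) < 1).
{ enough (0 < 1 - tan (u' / 2) * tan (v' / 2)) by lra.
  replace (1 - tan (u' / 2) * tan (v' / 2))
    with (cos ((u' + v') / 2) / (cos (u' / 2) * cos (v' / 2))).
  - apply Rdiv_lt_0_compat; nra.
  - replace ((u' + v') / 2) with (u' / 2 + v' / 2) by field.
    rewrite cos_plus; unfold tan; field; lra. }
pose proof (tan_half_le u u' ltac:(lra) ltac:(lra)).
pose proof (tan_half_le v v' ltac:(lra) ltac:(lra)).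
rewrite !sin_ratio by lra.
replace ((v - u) / 2) with (v / 2 - u / 2) by field.
replace ((v' - u') / 2) with (v' / 2 - u' / 2) by field.
replace ((u + v) / 2) with (u / 2 + v / 2) in * by field.
replace ((u' + v') / 2) with (u' / 2 + v' / 2) in * by field.
rewrite !cos_ratio_tan by lra.
set (t := tan (u / 2) * tan (v / 2)) in *.
set (t' := tan (u' / 2) * tan (v' / 2)) in *.
assert (Htt : 0 < t <= t') by (unfold t, t'; split; nra).
assert (Hle : t / (1 - t) <= t' / (1 - t')).
{ apply Rmult_le_compat; [lra | left; apply Rinv_0_lt_compat; lra | lra |].
  apply Rinv_le_contravar; lra. }
assert (0 < t / (1 - t)) by (apply Rdiv_lt_0_compat; lra).
apply G_incr; split; nra.
Qed.

Lemma Fminus_incr (r u v : R) :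
  0 < r -> 0 < u <= v -> v < PI / 2 -> Fminus r u <= Fminus r v.
Proof.
intros Hr Huv Hv; unfold Fminus; apply Ropp_le_contravar, G_incr.
assert (0 < cos v) by (apply cos_gt_0; lra).
assert (cos v <= cos u) by (apply cos_decr_1; lra).
split; nra.
Qed.

(** The function is the arc secant, with derivative [1 / (z * sqrt (z ^ 2 - 1))]. This decreases, so
    its value at the left end bounds the mean value. *)
Lemma arcsec_diff_le (x y : R) :
  1 < y -> y < x ->
  atan (sqrt (x ^ 2 - 1)) - atan (sqrt (y ^ 2 - 1)) <= (x - y) / (y * sqrt (y ^ 2 - 1)).
Proof.
intros Hy Hx.
destruct (MVT_cor2 (fun z => atan (sqrt (z ^ 2 - 1)))
            (fun z => / (z * sqrt (z ^ 2 - 1))) y x Hx) as [c [-> Hc]].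
- intros c Hc.
  assert (Hpos : 0 < c ^ 2 - 1) by nra.
  assert (Hs := sqrt_lt_R0 _ Hpos).
  assert (Hss := sqrt_sqrt _ (Rlt_le _ _ Hpos)).
  replace (/ (c * sqrt (c ^ 2 - 1)))
    with (/ (1 + sqrt (c ^ 2 - 1) ^ 2) * (/ (2 * sqrt (c ^ 2 - 1)) * (INR 2 * c ^ 1 - 0))).
  + apply (derivable_pt_lim_comp (fun z => sqrt (z ^ 2 - 1)) atan).
    * apply (derivable_pt_lim_comp (fun z => z ^ 2 - 1) sqrt).
      -- apply (derivable_pt_lim_minus (fun z => z ^ 2) (fun _ => 1)).
         ++ apply derivable_pt_lim_pow.
         ++ apply derivable_pt_lim_const.
      -- now apply derivable_pt_lim_sqrt.
    * apply derivable_pt_lim_atan.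
  + replace (1 + sqrt (c ^ 2 - 1) ^ 2) with (c * c) by (simpl pow in *; lra).
    simpl INR; field; lra.
- rewrite Rmult_comm; apply Rmult_le_compat_l; [lra |].
  assert (Hpos : 0 < y ^ 2 - 1) by nra.
  assert (Hs := sqrt_lt_R0 _ Hpos).
  assert (sqrt (y ^ 2 - 1) <= sqrt (c ^ 2 - 1)) by (apply sqrt_le_1_alt; nra).
  apply Rinv_le_contravar; nra.
Qed.

(** The argument of [G] exceeds [r] by [2 r sin (u/2) sin (v/2) / C]. Bound the sines by their
    arguments, and [C] below by [cos v] since [(u + v) / 2 < v]. *)
Lemma Fplus_le (r u v : R) :
  1 < r -> 0 < u < v -> v < PI / 2 ->
  Fplus r u v <= u * v / (2 * (cos v * sqrt (r ^ 2 - 1))).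
Proof.
intros Hr Huv Hv; unfold Fplus, G; rewrite sin_ratio by lra.
set (C := cos ((u + v) / 2)).
assert (Hc : 0 < cos v) by (apply cos_gt_0; lra).
assert (HC : cos v <= C) by (apply cos_decr_1; lra).
assert (Hs := sqrt_lt_R0 (r ^ 2 - 1) ltac:(nra)).
assert (Hsu : 0 < sin (u / 2) < u / 2)
  by (split; [apply sin_gt_0; lra | apply sin_lt_x; lra]).
assert (Hsv : 0 < sin (v / 2) < v / 2)
  by (split; [apply sin_gt_0; lra | apply sin_lt_x; lra]).
assert (Hrho : cos ((v - u) / 2) / C = 1 + 2 * (sin (u / 2) * sin (v / 2)) / C).
{ unfold C in *; replace ((v - u) / 2) with (v / 2 - u / 2) by field.
  replace ((u + v) / 2) with (u / 2 + v / 2) in * by field.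
  apply Rmult_eq_reg_r with (cos (u / 2 + v / 2)); [| lra].
  field_simplify; [| lra | lra].
  rewrite cos_minus, cos_plus; ring. }
rewrite Hrho.
assert (Hp : 0 < 2 * (sin (u / 2) * sin (v / 2)) / C)
  by (apply Rdiv_lt_0_compat; nra).
eapply Rle_trans; [apply arcsec_diff_le; nra |].
replace ((r * (1 + 2 * (sin (u / 2) * sin (v / 2)) / C) - r) / (r * sqrt (r ^ 2 - 1)))
  with (2 * (sin (u / 2) * sin (v / 2)) * / (C * sqrt (r ^ 2 - 1))) by (field; lra).
replace (u * v / (2 * (cos v * sqrt (r ^ 2 - 1))))
  with (2 * (u / 2 * (v / 2)) * / (cos v * sqrt (r ^ 2 - 1))) by (field; lra).
apply Rmult_le_compat; [nra | left; apply Rinv_0_lt_compat; nra | nra |].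
apply Rinv_le_contravar; nra.
Qed.

(** Here [r * cos u] is the left end of the interval, and [1 - cos u = 2 sin (u/2) ^ 2] is at most
    [u ^ 2 / 2]. *)
Lemma Fminus_le (r u : R) :
  0 < u < PI / 2 -> 1 < r * cos u ->
  Fminus r u <= u * u / (2 * (cos u * sqrt ((r * cos u) ^ 2 - 1))).
Proof.
intros Hu Hr; unfold Fminus, G.
assert (Hc : 0 < cos u) by (apply cos_gt_0; lra).
assert (Hs := sqrt_lt_R0 ((r * cos u) ^ 2 - 1) ltac:(nra)).
assert (Hsu : 0 < sin (u / 2) < u / 2)
  by (split; [apply sin_gt_0; lra | apply sin_lt_x; lra]).
assert (Hcos : cos u = 1 - 2 * sin (u / 2) * sin (u / 2)).
{ rewrite <- cos_2a_sin; f_equal; field. }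
assert (Hr0 : 0 < r) by nra.
assert (Hlt : r * cos u < r) by nra.
rewrite Ropp_minus_distr.
eapply Rle_trans; [apply arcsec_diff_le; assumption |].
replace ((r - r * cos u) / (r * cos u * sqrt ((r * cos u) ^ 2 - 1)))
  with ((1 - cos u) * / (cos u * sqrt ((r * cos u) ^ 2 - 1))) by (field; lra).
replace (u * u / (2 * (cos u * sqrt ((r * cos u) ^ 2 - 1))))
  with (u * u / 2 * / (cos u * sqrt ((r * cos u) ^ 2 - 1))) by (field; lra).
apply Rmult_le_compat_r; [left; apply Rinv_0_lt_compat |]; nra.
Qed.

(** * Propagating [condC] over ranges of [k] *)

(** Only [alphaA] is identified exactly; for [betaA] an upper bound suffices, by monotonicity of
    [Fplus]. *)
Lemma condC_step (r : R) (a : nat -> Z) (n : nat) (k : Z) :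
  0 < r -> is_cont_frac a (gam r) -> irrational (gam r) ->
  (forall j, (2 <= j)%nat -> Z.Odd (cf_den a j)) -> (2 <= n)%nat ->
  Rmax (Fplus r (delta r (qtilde a (S n))) (delta r (qtilde a n)))
       (Fminus r (delta r (qtilde a (S n)))) < delta r (qtilde a (S (S n))) ->
  (qtilde a (S n) <= k < qtilde a (S (S n)))%Z ->
  condC r k.
Proof.
intros Hr Hcf Hirr Hodd Hn Hmax Hk.
pose proof (proj1 Hcf) as Ha.
pose proof (cf_den_pos a n Ha).
pose proof (cf_den_lt a n Ha ltac:(lia)).
pose proof (cf_den_lt a (S n) Ha ltac:(lia)).
pose proof (cf_den_lt a (S (S n)) Ha ltac:(lia)).
pose proof (qtilde_odd a n (Hodd n ltac:(lia))).
pose proof (qtilde_odd a (S n) (Hodd (S n) ltac:(lia))).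
pose proof (qtilde_odd a (S (S n)) (Hodd (S (S n)) ltac:(lia))).
assert (Hk2 : (2 <= k)%Z) by lia.
assert (Halpha : alphaA r k = delta r (qtilde a (S n))).
{ apply alphaA_qtilde; auto; lia. }
assert (Hbeta : betaA r k <= delta r (qtilde a n)).
{ apply (betaA_spec r k Hirr Hk2); split.
  - exists (qtilde a n); split; [lia | reflexivity].
  - rewrite Halpha; intros Heq; apply delta_inj in Heq; auto; lia. }
(* Since [k + 1] may equal [qtilde a (S (S n))], best approximation is applied below the next
   denominator, that of index [n + 3]. *)
assert (Hdelta : delta r (qtilde a (S (S n))) <= delta r (k + 1)).
{ rewrite delta_qtilde by (auto; lia).
  apply delta_ge_cf_dist; auto; lia. }
destruct (alphaA_betaA_bounds r k Hirr Hk2) as [Hab Hb].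
pose proof (delta_bounds r (qtilde a n) Hirr) as Hbn.
apply Rmax_Rlt in Hmax; destruct Hmax as [HF HG]; rewrite <- Halpha in HF, HG.
split; [| lra].
eapply Rle_lt_trans; [| eapply Rlt_le_trans; [exact HF | exact Hdelta]].
apply Fplus_incr; lra.
Qed.

(** The left sides decrease as [k] grows, so only the right side has to be controlled. *)
Lemma condC_mono (r : R) (k l : Z) :
  0 < r -> irrational (gam r) -> (2 <= k <= l)%Z ->
  delta r (k + 1) <= delta r (l + 1) -> condC r k -> condC r l.
Proof.
intros Hr Hirr Hkl Hd [HF HG].
pose proof (alphaA_betaA_bounds r k Hirr ltac:(lia)).
pose proof (alphaA_betaA_bounds r l Hirr ltac:(lia)).
pose proof (alphaA_decr r k l ltac:(lia)).
pose proof (betaA_decr r k l Hirr ltac:(lia)).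
split.
- pose proof (Fplus_incr r (alphaA r l) (betaA r l) (alphaA r k) (betaA r k)
    ltac:(lra) ltac:(lra) ltac:(lra) ltac:(lra) ltac:(lra) ltac:(lra)); lra.
- pose proof (Fminus_incr r (alphaA r l) (alphaA r k)
    ltac:(lra) ltac:(lra) ltac:(lra)); lra.
Qed.

(** * Consequences of the hypotheses on the coefficients *)

Lemma gam_gt_third (r : R) : 1 < r -> 1 / 3 < gam r -> 2 < r.
Proof.
intros Hr Hg; pose proof PI_RGT_0 as HPI.
assert (Hat : PI / 3 < atan (sqrt (r ^ 2 - 1))).
{ unfold gam in Hg; apply Rmult_lt_compat_l with (r := PI) in Hg; [| lra].
  replace (PI * (1 / PI * atan (sqrt (r ^ 2 - 1))))
    with (atan (sqrt (r ^ 2 - 1))) in Hg by (field; lra).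
  lra. }
assert (Htan : tan (PI / 3) < sqrt (r ^ 2 - 1)).
{ rewrite <- (tan_atan (sqrt (r ^ 2 - 1))).
  destruct (atan_bound (sqrt (r ^ 2 - 1))).
  apply tan_increasing; lra. }
rewrite tan_PI3 in Htan.
assert (3 < r ^ 2 - 1).
{ apply sqrt_lt_0_alt, Htan. }
nra.
Qed.

(** The first two distances are [x] and [1 - 2 x], and they decrease strictly. *)
Lemma cont_frac_gt_third (a : nat -> Z) (x : R) :
  is_cont_frac a x -> irrational x -> a 0%nat = 0%Z -> a 1%nat = 2%Z -> 1 / 3 < x.
Proof.
intros Hcf Hirr H0 H1.
pose proof (cf_dist_decr a x 0 Hcf Hirr) as Hd1.
pose proof (cf_dist_decr a x 1 Hcf Hirr) as Hd2.
unfold cf_dist, cf_err in *; cbn in *; rewrite ?H0, ?H1 in *; cbn in *; lra.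
Qed.

Lemma cf_den_odd (a : nat -> Z) (n : nat) :
  a 1%nat = 2%Z -> Z.Odd (a 3%nat) ->
  (forall k : nat, (4 <= k)%nat -> Z.Even (a k)) ->
  (2 <= n)%nat -> Z.Odd (cf_den a n).
Proof.
intros H1 [m3 H3] Heven Hn.
assert (Hq1 : cf_den a 1 = 2%Z) by (cbn; now rewrite H1).
assert (H2 : cf_den a 2 = (2 * a 2%nat + 1)%Z).
{ rewrite cf_den_SS, Hq1; change (cf_den a 0) with 1%Z; ring. }
assert (H : Z.Odd (cf_den a n) /\ Z.Odd (cf_den a (S n))); [| apply H].
induction Hn as [|n Hn [IH1 IH2]].
- split; [now exists (a 2%nat) |].
  exists (m3 * cf_den a 2 + a 2%nat + 1)%Z.
  rewrite cf_den_SS, H3, H2, Hq1; ring.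
- split; [exact IH2 |].
  destruct n as [|[|n]]; [lia | lia |].
  rewrite cf_den_SS.
  destruct (Heven (S (S (S (S n)))) ltac:(lia)) as [m ->].
  destruct IH1 as [u ->].
  exists (m * cf_den a (S (S (S n))) + u)%Z; ring.
Qed.


Lemma step_of_growth (r : R) (a : nat -> Z) (n : nat) :
  2 < r -> is_cont_frac a (gam r) -> irrational (gam r) ->
  (forall j, (2 <= j)%nat -> Z.Odd (cf_den a j)) -> (2 <= n)%nat ->
  (3 <= cf_den a (S n))%Z ->
  PI / (cos (PI / IZR (cf_den a (S n))) *
        sqrt (r ^ 2 * cos (PI / IZR (cf_den a (S (S n)))) ^ 2 - 1))
    * IZR (a (S (S (S n))) + 2) <= IZR (cf_den a (S n)) ->
  Rmax (Fplus r (delta r (qtilde a (S n))) (delta r (qtilde a n)))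
       (Fminus r (delta r (qtilde a (S n))))
  < delta r (qtilde a (S (S n))).
Proof.
intros Hr Hcf Hirr Hodd Hn Hq3 Hgrow; pose proof PI_RGT_0 as HPI.
pose proof (proj1 Hcf) as Ha; rewrite plus_IZR in Hgrow.
pose proof (delta_bounds r (qtilde a n) Hirr) as Hv.
rewrite !delta_qtilde in * by (auto; lia).
destruct (cf_dist_decr a (gam r) n Hcf Hirr) as [Hd1 Hd0].
destruct (cf_dist_decr a (gam r) (S n) Hcf Hirr) as [Hd2 Hd12].
destruct (cf_dist_decr a (gam r) (S (S n)) Hcf Hirr) as [Hd3 Hd23].
pose proof (cf_dist_den a (gam r) n) as He0.
pose proof (cf_dist_den a (gam r) (S n)) as He1.
pose proof (cf_dist_den a (gam r) (S (S n))) as He2.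
pose proof (IZR_le _ _ (cf_den_pos a n Ha)) as Hq0.
pose proof (IZR_lt _ _ (cf_den_lt a (S n) Ha ltac:(lia))) as Hq12.
pose proof (IZR_le _ _ (Ha (S (S (S n))) ltac:(lia))) as Hb.
apply IZR_le in Hq3; rewrite cf_den_SS, plus_IZR, mult_IZR in He2.
set (q1 := IZR (cf_den a (S n))) in *; set (q2 := IZR (cf_den a (S (S n)))) in *.
set (b := IZR (a (S (S (S n))))) in *.
set (d0 := cf_dist a (gam r) n) in *; set (d1 := cf_dist a (gam r) (S n)) in *.
set (d2 := cf_dist a (gam r) (S (S n))) in *.
set (d3 := cf_dist a (gam r) (S (S (S n)))) in *.
assert (Hx1 : PI / q1 <= PI / 3)
  by (apply Rmult_le_compat_l; [lra | apply Rinv_le_contravar; lra]).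
assert (Hx2 : PI / q2 <= PI / q1)
  by (apply Rmult_le_compat_l; [lra | apply Rinv_le_contravar; lra]).
assert (Hx0 : 0 < PI / q2) by (apply Rdiv_lt_0_compat; lra).
assert (Hv1 : PI * d0 <= PI / q1).
{ apply Rmult_le_compat_l; [lra |].
  apply Rmult_le_reg_l with q1; [lra |]; rewrite Rinv_r by lra; nra. }
assert (Hu2 : PI * d1 <= PI / q2).
{ apply Rmult_le_compat_l; [lra |].
  apply Rmult_le_reg_l with q2; [lra |]; rewrite Rinv_r by lra; nra. }
assert (Hd : 0 < PI * d1 < PI * d0) by nra.
assert (Hc3 := cos_PI3).
assert (Hc1 : 1 / 2 <= cos (PI / q1)) by (rewrite <- Hc3; apply cos_decr_1; lra).
assert (Hc2 : cos (PI / q1) <= cos (PI / q2)) by (apply cos_decr_1; lra).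
assert (Hcv : cos (PI / q1) <= cos (PI * d0)) by (apply cos_decr_1; lra).
assert (Hcu : cos (PI / q2) <= cos (PI * d1)) by (apply cos_decr_1; lra).
assert (Hcu1 : cos (PI * d1) <= 1) by apply COS_bound.
set (c1 := cos (PI / q1)) in *; set (c2 := cos (PI / q2)) in *.
(* As [q1 >= 3], the cosine [c2] is at least [cos (PI / 3) = 1 / 2], and [r > 2]. *)
assert (Hrad : 0 < r ^ 2 * c2 ^ 2 - 1).
{ assert (1 < r * c2) by nra; nra. }
assert (HS := sqrt_lt_R0 _ Hrad).
(* The root [s] is below the roots in both [Fplus_le] and [Fminus_le], as [c1] is below both
   cosines, so [c1 * s] serves for the two bounds. *)
assert (HSr : sqrt (r ^ 2 * c2 ^ 2 - 1) <= sqrt (r ^ 2 - 1))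
  by (apply sqrt_le_1_alt; assert (c2 ^ 2 <= 1) by nra; nra).
assert (HSu : sqrt (r ^ 2 * c2 ^ 2 - 1) <= sqrt ((r * cos (PI * d1)) ^ 2 - 1)).
{ apply sqrt_le_1_alt; rewrite Rpow_mult_distr.
  assert (c2 ^ 2 <= cos (PI * d1) ^ 2) by nra; nra. }
set (s := sqrt (r ^ 2 * c2 ^ 2 - 1)) in *.
assert (Hw : 0 < / (c1 * s)) by (apply Rinv_0_lt_compat; nra).
(* Both terms are at most this, as [d0 < 1 / q1], [d1 < 1 / q2]
   and [1 / q2 < (b + 2) * d2]. *)
assert (Hmain : PI * d1 * (PI * d0) / 2 * / (c1 * s) < PI * d2).
{ unfold Rdiv at 1 in Hgrow.
  set (w := / (c1 * s)) in *.
  assert (H1 : q1 * d0 < 1) by nra.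
  assert (H2 : q2 * d1 < 1) by nra.
  (* In [He2] replace [q1] by the larger [q2] and [d3] by the larger [d2]. *)
  assert (H3 : 1 < (b + 2) * q2 * d2) by nra.
  apply Rmult_lt_reg_l with ((b + 2) * q2); [nra |].
  (* The growth hypothesis reads [PI * w * (b + 2) <= q1]; multiply it by [d0]. *)
  assert (H4 : PI * w * (b + 2) * d0 <= 1) by nra.
  assert (H5 : (PI * w * (b + 2) * d0) * (q2 * d1) <= 1).
  { assert (0 <= PI * w * (b + 2) * d0)
      by (apply Rmult_le_pos; [apply Rmult_le_pos; [apply Rmult_le_pos |] |]; lra).
    assert (0 <= q2 * d1) by nra.
    nra. }
  replace ((b + 2) * q2 * (PI * d1 * (PI * d0) / 2 * w))
    with (PI / 2 * ((PI * w * (b + 2) * d0) * (q2 * d1))) by field.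
  replace ((b + 2) * q2 * (PI * d2)) with (PI * ((b + 2) * q2 * d2)) by ring.
  nra. }
apply Rmax_lub_lt; eapply Rle_lt_trans; try exact Hmain.
- eapply Rle_trans; [apply Fplus_le; lra |].
  replace (PI * d1 * (PI * d0) / (2 * (cos (PI * d0) * sqrt (r ^ 2 - 1))))
    with (PI * d1 * (PI * d0) / 2 * / (cos (PI * d0) * sqrt (r ^ 2 - 1)))
    by (field; lra).
  apply Rmult_le_compat_l; [nra |].
  apply Rinv_le_contravar; [nra |]; apply Rmult_le_compat; lra.
- eapply Rle_trans; [apply Fminus_le; [lra | nra] |].
  replace (PI * d1 * (PI * d1) / (2 * (cos (PI * d1) * sqrt ((r * cos (PI * d1)) ^ 2 - 1))))
    with (PI * d1 * (PI * d1) / 2 * / (cos (PI * d1) * sqrt ((r * cos (PI * d1)) ^ 2 - 1)))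
    by (field; lra).
  (* Since [d1 < d0], the square of [d1] is below the product in [Hmain]. *)
  apply Rmult_le_compat; [nra | left; apply Rinv_0_lt_compat; nra | nra |].
  apply Rinv_le_contravar; [nra |]; apply Rmult_le_compat; lra.
Qed.

(** * Assembling the three statements *)

Lemma locate_between (f : nat -> Z) (m : nat) (k : Z) :
  (forall j, (m <= j)%nat -> (f j < f (S j))%Z) -> (f m <= k)%Z ->
  exists j, (m <= j)%nat /\ (f j <= k < f (S j))%Z.
Proof.
intros Hf Hk; apply NNPP; intros Hno.
(* If no window contained [k], the sequence would stay below [k] while gaining at least 1 at each
   step. *)
assert (H : forall i, (f m + Z.of_nat i <= f (m + i)%nat <= k)%Z).
{ induction i as [|i IH].
  - rewrite Nat.add_0_r; lia.
  - rewrite Nat.add_succ_r; specialize (Hf (m + i)%nat ltac:(lia)).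
    split; [lia |].
    apply Z.nlt_ge; intros Hlt; apply Hno; exists (m + i)%nat; lia. }
specialize (H (Z.to_nat (k - f m + 1))); lia.
Qed.

Theorem theorem14 (A RA : R) (a : nat -> Z) (j0 : nat)
  (A_pos : 0 < A)
  (RA_gt1 : 1 < RA)
  (RA_def : A = omega3 * Rpower (RA ^ 2 - 1) (3 / 2))
  (gam_irr : irrational (gam RA))
  (gam_cf : is_cont_frac a (gam RA))
  (a_0 : a 0%nat = 0%Z)
  (a_1 : a 1%nat = 2%Z)
  (a_3 : Z.Odd (a 3%nat))
  (a_even : forall k : nat, (4 <= k)%nat -> Z.Even (a k))
  (j0_ge3 : (3 <= j0)%nat) :
  ((forall j : nat, (j0 <= j)%nat ->
      PI / (cos (PI / IZR (cf_den a j)) *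
            sqrt (RA ^ 2 * cos (PI / IZR (cf_den a (j + 1))) ^ 2 - 1))
        * IZR (a (j + 2)%nat + 2)
      <= IZR (cf_den a j)) ->
   forall k : Z, (qtilde a j0 <= k)%Z -> condC RA k)
  /\
  ((4 <= j0)%nat ->
   (forall j : nat, (4 <= j <= j0)%nat ->
      Rmax (Fplus RA (delta RA (qtilde a (j - 1))) (delta RA (qtilde a (j - 2))))
           (Fminus RA (delta RA (qtilde a (j - 1))))
      < delta RA (qtilde a j)) ->
   forall k : Z, (qtilde a 3 <= k < qtilde a j0)%Z -> condC RA k)
  /\
  ((3 <= qtilde a 2 <= qtilde a 3 - 2)%Z ->
   condC RA (qtilde a 2 - 1) ->
   forall k : Z, (qtilde a 2 <= k <= qtilde a 3 - 2)%Z -> condC RA k).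
Proof.
assert (Hodd : forall j, (2 <= j)%nat -> Z.Odd (cf_den a j))
  by (intros; now apply cf_den_odd).
pose proof (proj1 gam_cf) as Ha.
assert (Hr : 2 < RA).
{ apply gam_gt_third; [assumption |]; now apply (cont_frac_gt_third a). }
assert (Hqt : forall j, (2 <= j)%nat -> (qtilde a j < qtilde a (S j))%Z).
{ intros j Hj; pose proof (cf_den_lt a j Ha ltac:(lia)).
  pose proof (qtilde_odd a j (Hodd j Hj)).
  pose proof (qtilde_odd a (S j) (Hodd (S j) ltac:(lia))); lia. }
assert (Hq3 : forall j, (2 <= j)%nat -> (3 <= cf_den a j)%Z).
{ intros j Hj; induction Hj as [|j Hj IH].
  - pose proof (Ha 2%nat ltac:(lia)); rewrite cf_den_SS.
    replace (cf_den a 1) with 2%Z by (cbn; now rewrite a_1).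
    pose proof (cf_den_pos a 0 Ha); lia.
  - pose proof (cf_den_lt a j Ha ltac:(lia)); lia. }
split; [| split].
- intros Hgrow k Hk.
  destruct (locate_between (qtilde a) j0 k) as [[|n] [Hj Hjk]]; auto; [|lia |].
  { intros j Hj; apply Hqt; lia. }
  apply (condC_step RA a n); auto; [lra | lia |].
  apply step_of_growth; auto; [lia | apply Hq3; lia |].
  specialize (Hgrow (S n) Hj).
  replace (S n + 1)%nat with (S (S n)) in Hgrow by lia.
  replace (S n + 2)%nat with (S (S (S n))) in Hgrow by lia.
  exact Hgrow.
- intros Hj0 Hmax k Hk.
  destruct (locate_between (qtilde a) 3 k) as [[|n] [Hj Hjk]]; [|lia |lia |].
  { intros j Hj; apply Hqt; lia. }
  (* The window containing [k] starts before [j0], so the hypothesis is available at its right end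
     [S (S n)]. *)
  assert (Hlt : (S n < j0)%nat).
  { apply Nat.nle_gt; intros Hle.
    assert (Hmono : forall i, (qtilde a j0 <= qtilde a (j0 + i))%Z).
    { induction i as [|i IH]; [rewrite Nat.add_0_r; lia |].
      rewrite Nat.add_succ_r; pose proof (Hqt (j0 + i)%nat ltac:(lia)); lia. }
    specialize (Hmono (S n - j0)%nat).
    replace (j0 + (S n - j0))%nat with (S n) in Hmono by lia; lia. }
  apply (condC_step RA a n); auto; [lra | lia |].
  specialize (Hmax (S (S n)) ltac:(lia)).
  replace (S (S n) - 1)%nat with (S n) in Hmax by lia.
  replace (S (S n) - 2)%nat with n in Hmax by lia.
  exact Hmax.
- intros Hq23 HC k Hk.
  (* The starting index is at least 2 because [qtilde a 2 >= 3]. *)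
  apply (condC_mono RA (qtilde a 2 - 1)); auto; [lra | lia |].
  replace (qtilde a 2 - 1 + 1)%Z with (qtilde a 2) by ring.
  rewrite delta_qtilde by auto.
  pose proof (qtilde_odd a 3 (Hodd 3%nat ltac:(lia))).
  (* The bound [k <= qtilde a 3 - 2] keeps [2 (k + 1) - 1] strictly below [q_3]. *)
  apply delta_ge_cf_dist; auto; lia.
Qed.
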